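(* Let $A=\mathrm{GF}(p)$ with $p$ prime. The $\mathsf{L}$-stable classes of operations on $A$ are exactly $\mathcal{O}_A$, $\mathsf{D}_k$ for $k\in\{0,1,2,\dots\}$, and $\emptyset$.
   Context: An operation on $A$ is a map $f\colon A^n\to A$ with $n\geq 1$ (its arity); $\mathcal{O}_A$ is the set of all operations on $A$. For classes $C,K\subseteq\mathcal{O}_A$, $CK:=\{f(g_1,\dots,g_n)\mid f\in C\ n\text{-ary},\ g_1,\dots,g_n\in K\ \text{all } m\text{-ary},\ n,m\geq 1\}$, where $f(g_1,\dots,g_n)(\mathbf{x})=f(g_1(\mathbf{x}),\dots,g_n(\mathbf{x}))$. A class $K\subseteq\mathcal{O}_A$ is $C$-stable if $KC\subseteq K$ and $CK\subseteq K$. Each $n$-ary operation on $A=\mathrm{GF}(p)$ is represented by a unique reduced polynomial over $\mathrm{GF}(p)$ in $n$ variables, i.e. one in which no variable has exponent greater than $p-1$; the degree of the operation is the total degree of this polynomial, with $\deg(0):=0$. $\mathsf{D}_k$ is the set of all operations on $A$ of degree at most $k$, and $\mathsf{L}:=\mathsf{D}_1$ (a clone). *)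

(* Defs.v *)
From HB Require Import structures.
From mathcomp Require Import all_boot all_order all_algebra.
From mathcomp Require Import boolp classical_sets.
From mathcomp Require Import freeg mpoly.

Set Implicit Arguments.
Unset Strict Implicit.
Unset Printing Implicit Defensive.

Import Order.TTheory GRing.Theory.

Local Open Scope ring_scope.
Local Open Scope classical_set_scope.

(* Arities are at least 1, so the index [n] stands for arity [n.+1]. *)
Definition nary (A : Type) (n : nat) : Type := (n.+1).-tuple A -> A.

Definition operation (A : Type) : Type := {n : nat & nary A n}.

Definition Op (A : Type) (n : nat) (f : nary A n) : operation A :=
  existT (nary A) n f.

Definition compose (A : Type) (n m : nat) (f : nary A n)
    (g : 'I_n.+1 -> nary A m) : nary A m :=
  fun x => f [tuple g i x | i < n.+1].

Definition class_comp (A : Type) (C K : set (operation A)) :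
    set (operation A) :=
  [set h | exists (n m : nat) (f : nary A n) (g : 'I_n.+1 -> nary A m),
     [/\ C (Op f), (forall i, K (Op (g i))) & h = Op (compose f g)]].

Definition stable (A : Type) (C K : set (operation A)) : Prop :=
  class_comp K C `<=` K /\ class_comp C K `<=` K.

Definition reduced (p n : nat) (q : {mpoly 'F_p[n]}) : Prop :=
  forall m : 'X_{1..n}, m \in msupp q -> forall i : 'I_n, (m i <= p.-1)%N.

Definition represents (p n : nat) (q : {mpoly 'F_p[n.+1]}) (f : nary 'F_p n) :
    Prop :=
  forall x : (n.+1).-tuple 'F_p, f x = q.@[tnth x].

(* [msize q] is the total degree plus one when [q != 0], and [msize 0 = 0];
   hence [(msize q).-1] is the degree with the convention deg 0 = 0. *)
Definition has_degree (p n : nat) (f : nary 'F_p n) (d : nat) : Prop :=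
  exists q : {mpoly 'F_p[n.+1]},
    [/\ reduced q, represents q f & d = (msize q).-1].

Definition D (p k : nat) : set (operation 'F_p) :=
  [set f | exists2 d : nat, has_degree (projT2 f) d & (d <= k)%N].

Arguments D : clear implicits.

Definition L (p : nat) : set (operation 'F_p) := D p 1%N.

Arguments L : clear implicits.

(* Main.v *)
(* Let [K] be a nonempty stable class. It contains the constants and is closed
   under linear combinations and affine substitutions. Let [f] in [K] be given
   by a reduced polynomial with a monomial [X^m] of top degree [d]. Substitute
   for [x_i] the sums of affine forms [l_j], over the [j] attached to [i] ([m i]
   of them for each [i]) that lie in a set [S], and take the alternating sum over
   all [S]. What remains is a scalar multiple of the product of the [d] forms
   [l_j]. The scalar is the coefficient of [X^m] times the number of permutations
   of the forms preserving the attachment, that is the product of the [(m i)!],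
   and it is nonzero since every [m i < p]. Hence [K] contains all monomials of
   degree at most [d], so all of [D_d]. Thus [K] is [D_d] for the largest degree
   [d] occurring in it, or everything if the degrees are unbounded. *)
Require Import Defs.
From mathcomp Require Import all_boot all_order all_algebra.
From mathcomp Require Import fingroup perm action cyclic pgroup finfield.
From mathcomp Require Import boolp classical_sets.
From mathcomp Require Import mpoly.

Set Implicit Arguments.
Unset Strict Implicit.
Unset Printing Implicit Defensive.

Import GRing.Theory.

(** * Polarization by inclusion-exclusion over sets of slots *)

Section Polarization.

Local Open Scope ring_scope.

(** After distributing, each index in [A] contributes the factor 1 and each index outside [A] the
    factor 1 - 1 = 0. *)
Lemma sum_superset_sign (R : comPzRingType) (J : finType) (A : {set J}) :
  \sum_(S : {set J} | A \subset S) (-1) ^+ #|~: S| = (A == [set: J])%:R :> R.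
Proof.
have sgnE (S : {set J}) :
    (if A \subset S then (-1) ^+ #|~: S| else 0 : R) =
    \prod_j (if j \in S then 1 else - (j \notin A)%:R).
  rewrite (bigID (mem S)) /= big1 ?mul1r => [|j ->] //.
  rewrite (eq_bigr (fun j => - (j \notin A)%:R)) => [|j /negPf->] //.
  case: ifPn => [/fintype.subsetP sAS | /fintype.subsetPn[j jA jS]]; last first.
    by rewrite (bigD1 j) //= jA oppr0 mul0r.
  rewrite (eq_bigr (fun=> -1)) => [|j jS].
    by rewrite prodr_const; congr (_ ^+ _); apply: eq_card => j; rewrite inE.
  by rewrite (contra (sAS j) jS).
rewrite big_mkcond (eq_bigr _ (fun S _ => sgnE S)) -bigA_distr.
rewrite -finset.subTset;
case: (boolP (_ \subset A)) => [/fintype.subsetP sTA | /fintype.subsetPn[j _ jA]].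
  by apply: big1 => j _; rewrite sTA ?inE //= oppr0 addr0.
by rewrite (bigD1 j) //= jA subrr mul0r.
Qed.

(* Ryser's inclusion-exclusion formula for the permanent, for rectangular arrays. *)
Lemma ryser (R : comPzRingType) (T J : finType) (a : T -> J -> R) :
  \sum_(S : {set J}) (-1) ^+ #|~: S| * \prod_t \sum_(j in S) a t j =
  \sum_(f : {ffun T -> J} | f @: [set: T] == [set: J]) \prod_t a t (f t).
Proof.
under eq_bigr => S _ do rewrite bigA_distr_big big_distrr.
rewrite /= (exchange_big_dep predT) //= [RHS]big_mkcond; apply: eq_bigr => f _.
rewrite -mulr_suml (eq_bigl (fun S : {set J} => f @: [set: T] \subset S)).
  by rewrite sum_superset_sign; case: ifP; rewrite ?mul1r ?mul0r.
move=> S; apply/ffun_onP/fintype.subsetP => [fS _ /imsetP[t _ ->] // | fS t].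
exact/fS/finset.imset_f.
Qed.

Lemma tag_perm_group_set (T : finType) (rT : eqType) (h : T -> rT) :
  group_set [set s : {perm T} | [forall x, h (s x) == h x]].
Proof.
apply/group_setP; split=> [|s t]; first by rewrite inE; apply/forallP=> x; rewrite perm1.
rewrite !inE => /forallP hs /forallP ht; apply/forallP=> x.
by rewrite permM (eqP (ht _)).
Qed.

(* An element of order [p] in this group would have an orbit of size [p] inside a
   fibre of [h]. *)
Lemma prime_ndvd_fibre_perms (T : finType) (rT : eqType) (h : T -> rT) (p : nat) :
  prime p -> (forall x, #|[set y | h y == h x]| < p)%N ->
  ~~ (p %| #|[set s : {perm T} | [forall x, h (s x) == h x]]|)%N.
Proof.
move=> p_pr small; apply/negP=> /(Cauchy (G := Group (tag_perm_group_set h)) p_pr).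
case=> s /=; rewrite inE => /forallP hs os.
have [x sx] : exists x, s x != x.
  apply/existsP; apply: contraT; rewrite negb_exists => /forallP fix_s.
  have s1 : s = 1%g.
    by apply/permP=> x; rewrite perm1; apply/eqP; rewrite -[_ == _]negbK fix_s.
  by move: p_pr; rewrite -os s1 order1.
have hpow k y : h ((s ^+ k)%g y) = h y.
  by elim: k => [|k IH]; rewrite ?perm1 // expgSr permM (eqP (hs _)).
have sub : porbit s x \subset [set y | h y == h x].
  by apply/fintype.subsetP=> y /porbitP[k ->]; rewrite inE hpow.
have porbitE : porbit s x = orbit 'P <[s]> x by rewrite porbit.unlock.
have := dvdn_orbit 'P <[s]> x; rewrite -orderE os.
case/primeP: (p_pr) => _ dvdp /dvdp /orP[] /eqP cardo; last first.
  by have := leq_ltn_trans (subset_leq_card sub) (small x); rewrite porbitE cardo ltnn.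
have: s x \in porbit s x by have := mem_porbit s 1 x; rewrite expg1.
rewrite porbitE (card_orbit1 cardo).
by rewrite inE (negPf sx).
Qed.

(** Padding with ones lets a monomial of lower degree fill a larger number of slots. *)
Lemma prod_nth_pad (R : comPzRingType) (s : seq R) (N : nat) :
  (size s <= N)%N -> \prod_(k < N) nth 1 s k = \prod_(y <- s) y.
Proof.
move=> leN; rewrite [RHS](big_nth 1) [RHS]big_mkord.
rewrite [RHS](big_ord_widen N (nth 1 s)) // [RHS]big_mkcond.
by apply: eq_bigr => k _; case: ltnP => // /(nth_default 1)->.
Qed.

(* One slot per variable occurrence in the monomial ['X_[m]]. *)
Definition slot (n : nat) (m : 'X_{1..n}) : finType := {i : 'I_n & 'I_(m i)}.

Lemma card_slot_fibre (n : nat) (m : 'X_{1..n}) (i : 'I_n) :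
  #|[set j : slot m | tag j == i]| = m i.
Proof.
have := sig_big_dep (op := addn) (J := fun i => 'I_(m i)) (fun i' => i' == i)
  (fun _ _ => true) (fun _ _ => 1%N).
rewrite big_pred1_eq => sumE.
rewrite -[RHS](card_ord (m i)) -sum1_card -[RHS]sum1_card sumE.
by apply: eq_bigl => j; rewrite inE andbT.
Qed.

Lemma prod_slot (R : comPzRingType) (n : nat) (m : 'X_{1..n}) (u : 'I_n -> R) :
  \prod_(t : slot m) u (tag t) = \prod_i u i ^+ m i.
Proof.
have := sig_big_dep (op := *%R) (J := fun i => 'I_(m i)) predT
  (fun _ _ => true) (fun i _ => u i).
move=> /= <-; apply: eq_bigr => i _.
by rewrite prodr_const card_ord.
Qed.

Lemma card_slot (n : nat) (m : 'X_{1..n}) : #|{: slot m}| = mdeg m.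
Proof.
have := sig_big_dep (op := addn) (J := fun i => 'I_(m i)) predT
  (fun _ _ => true) (fun _ _ => 1%N).
rewrite mdegE -sum1_card => <-.
by apply: eq_bigr => i _; rewrite sum1_card card_ord.
Qed.

(** A Young subgroup of the symmetric group on the slots, of order the product of the [(m i)!]. *)
Definition slot_perms (n : nat) (m : 'X_{1..n}) : {set {perm slot m}} :=
  [set s : {perm slot m} | [forall j, tag (s j) == tag j]].

(* The alternating sum keeps only the terms of the expansion that use every [l j];
   by degree these use each exactly once. *)
Lemma polarization (R : comPzRingType) (n : nat) (m m' : 'X_{1..n}) (l : slot m -> R) :
  (mdeg m' <= mdeg m)%N ->
  \sum_(S : {set slot m}) (-1) ^+ #|~: S| *
    \prod_i (\sum_(j in S | tag j == i) l j) ^+ m' i =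
  (m' == m)%:R * #|slot_perms m|%:R * \prod_j l j.
Proof.
move=> le_m'm.
(* The zero entries encode the attachment of slots to variables, so that [ryser] applies to a full
   array. *)
pose a (t : slot m') (j : slot m) := if tag j == tag t then l j else 0.
transitivity (\sum_(S : {set slot m}) (-1) ^+ #|~: S| * \prod_t \sum_(j in S) a t j).
  apply: eq_bigr => S _; rewrite -prod_slot; congr (_ * _).
  by apply: eq_bigr => t _; rewrite big_mkcondr.
rewrite ryser.
pose good (f : {ffun slot m' -> slot m}) :=
  (f @: [set: slot m'] == [set: slot m]) && [forall t, tag (f t) == tag t].
transitivity (\sum_(f | good f) \prod_t l (f t)).
  rewrite /good big_mkcondr; apply: eq_bigr => f _; case: ifPn => [/forallP tf | ].
    by apply: eq_bigr => t _; rewrite /a tf.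
  by rewrite negb_forall => /existsP[t tf]; rewrite (bigD1 t) //= /a (negPf tf) mul0r.
(* A surjection from [mdeg m'] slots onto [mdeg m] slots is bijective because
   [mdeg m' <= mdeg m]. *)
have good_bij f : good f -> bijective f.
  case/andP=> /eqP f_onto _.
  have card_le : (#|[set: slot m']| <= #|f @: [set: slot m']|)%N.
    by rewrite f_onto !cardsT !card_slot.
  have/imset_injP inj_f : #|f @: [set: slot m']| == #|[set: slot m']|.
    by rewrite eqn_leq leq_imset_card.
  apply: inj_card_bij; first by move=> x y; apply: inj_f; rewrite inE.
  rewrite !card_slot -[mdeg m]card_slot -cardsT -f_onto.
  by rewrite -card_slot -cardsT leq_imset_card.
(* A tag-preserving bijection matches the fibres of [tag], whose sizes are the exponents. *)
have good_eq f : good f -> m' = m.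
  move=> gf; have [g fK gK] := good_bij f gf; have/andP[_ /forallP tf] := gf.
  apply/mnmP=> i; rewrite -!card_slot_fibre -(card_imset _ (can_inj fK)).
  apply: eq_card => j; rewrite inE; apply/imsetP/idP => [[t ti ->] | ji].
    by rewrite (eqP (tf t)); move: ti; rewrite inE.
  by exists (g j); rewrite ?gK // inE -(eqP (tf _)) gK.
have [eq_m | neq_m] := eqVneq m' m; last first.
  by rewrite !mul0r big1 // => f /good_eq/eqP; rewrite (negPf neq_m).
subst m'; rewrite mul1r.
transitivity (\sum_(f | good f) \prod_j l j).
  apply: eq_bigr => f gf.
  by rewrite [RHS](reindex f) //; apply: onW_bij (good_bij f gf).
rewrite sumr_const -[LHS]mulr_natl; congr (_%:R * _).
pose h (s : {perm slot m}) := [ffun j => s j].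
have inj_h : injective h.
  by move=> s s' /ffunP hss; apply/permP=> j; have := hss j; rewrite !ffunE.
rewrite -(card_imset _ inj_h); apply: eq_card => f.
apply/idP/imsetP => [gf | [s + ->]].
  have inj_f := bij_inj (good_bij f gf).
  exists (perm inj_f); last by apply/ffunP=> j; rewrite ffunE permE.
  by rewrite inE; have/andP[_ /forallP tf] := gf; apply/forallP=> j; rewrite permE.
rewrite inE => /forallP ts; apply/andP; split; last by apply/forallP=> j; rewrite ffunE.
rewrite eqEcard finset.subsetT card_imset ?leqnn //.
by move=> x y; rewrite !ffunE; apply: perm_inj.
Qed.

End Polarization.

(** * Degree classes over GF(p) *)

Lemma eq_class (A : Type) (K : set (operation A)) (n : nat) (f g : nary A n) :
  f =1 g -> K (Op f) -> K (Op g).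
Proof. by move=> /funext->. Qed.

Section DegreeClasses.

Local Open Scope ring_scope.

Variable p : nat.
Hypothesis p_pr : prime p.

Lemma expFp (x : 'F_p) : x ^+ p.-1.+1 = x.
Proof.
have cardF : #|'F_p| = p.-1.+1 by rewrite card_Fp // prednK ?prime_gt0.
by have := expf_card x; rewrite cardF.
Qed.

(** Since x ^ p = x, positive exponents matter only modulo p - 1. The shift by one keeps them
    positive, as x ^ 0 and x ^ (p - 1) differ at 0. *)
Definition reduce_exp (e : nat) : nat := if e is e'.+1 then (e' %% p.-1).+1 else 0%N.

Lemma reduce_exp_le (e : nat) : (reduce_exp e <= e)%N.
Proof. by case: e => //= e; rewrite ltnS leq_mod. Qed.

Lemma reduce_exp_small (e : nat) : (reduce_exp e <= p.-1)%N.
Proof. by case: e => //= e; rewrite ltn_pmod // -ltnS prednK ?prime_gt1 ?prime_gt0. Qed.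

Lemma expr_reduce_exp (x : 'F_p) (e : nat) : x ^+ reduce_exp e = x ^+ e.
Proof.
case: e => //= e; rewrite {2}(divn_eq e p.-1).
elim: (e %/ p.-1)%N => [|c IH]; first by rewrite mul0n add0n.
by rewrite mulSn -addnA -addnS exprD {}IH exprS mulrA -exprSr expFp.
Qed.

(** Applying [reduce_exp] to all exponents keeps the function and does not raise the degree, so any
    representing polynomial will do. The bound is [k.+1] because [msize] is the degree plus one on
    nonzero polynomials. *)
Lemma in_D (k n : nat) (f : nary 'F_p n) :
  D p k (Op f) <-> exists2 q : {mpoly 'F_p[n.+1]}, represents q f & (msize q <= k.+1)%N.
Proof.
split=> [[d [q [red_q rep_q ->]] lek] | [q rep_q szq]].
  by exists q => //; case: (msize q) lek.
pose red (m : 'X_{1..n.+1}) := [multinom reduce_exp (m i) | i < n.+1].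
pose r := \sum_(m <- msupp q) q@_m *: 'X_[red m].
have red_le m : (mdeg (red m) <= mdeg m)%N.
  by rewrite !mdegE leq_sum // => i _; rewrite mnmE reduce_exp_le.
have szr : (msize r <= k.+1)%N.
  apply: leq_trans (msize_sum _ _ _) _; rewrite big_seq.
  elim/big_ind: _ => // [a b|m mq]; first by rewrite geq_max => -> ->.
  apply: leq_trans (msizeZ_le _ _) _; rewrite msizeX ltnS (leq_trans (red_le m)) //.
  by rewrite -ltnS (leq_trans (msize_mdeg_lt mq)).
exists (msize r).-1; last by case: (msize r) szr.
exists r; split=> // [m /msupp_sum_le/flatten_mapP[m' _] | x].
  move=> /msuppZ_le; rewrite msuppX inE => /eqP-> i.
  by rewrite mnmE reduce_exp_small.
rewrite [LHS]rep_q mevalE /r raddf_sum /=; apply: eq_bigr => m _.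
rewrite mevalZ mevalX; congr (_ * _); apply: eq_bigr => i _.
by rewrite mnmE expr_reduce_exp.
Qed.

Lemma D_le (a b : nat) : (a <= b)%N -> (D p a `<=` D p b)%classic.
Proof. by move=> leab f [d fd led]; exists d => //; apply: leq_trans leab. Qed.

Lemma D_const (k n : nat) (c : 'F_p) : D p k (Op (fun _ : n.+1.-tuple 'F_p => c)).
Proof.
apply/in_D; exists c%:MP => [x|]; first by rewrite mevalC.
by rewrite msizeC; case: eqP.
Qed.

Lemma D_proj (n : nat) (i : 'I_n.+1) : D p 1 (Op (fun x : n.+1.-tuple 'F_p => tnth x i)).
Proof.
apply/in_D; exists 'X_i => [x|]; first by rewrite mevalXU.
by rewrite msizeX mdeg1.
Qed.

Lemma D_add (k n : nat) (f g : nary 'F_p n) :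
  D p k (Op f) -> D p k (Op g) -> D p k (Op (fun x => f x + g x)).
Proof.
move=> /in_D[q qf szq] /in_D[r rg szr]; apply/in_D.
exists (q + r) => [x|]; first by rewrite mevalD qf rg.
by apply: leq_trans (msizeD_le _ _) _; rewrite geq_max szq.
Qed.

Lemma D_mul (a b n : nat) (f g : nary 'F_p n) :
  D p a (Op f) -> D p b (Op g) -> D p (a + b) (Op (fun x => f x * g x)).
Proof.
move=> /in_D[q qf szq] /in_D[r rg szr]; apply/in_D.
exists (q * r) => [x|]; first by rewrite mevalM qf rg.
have [->|q0] := eqVneq q 0; first by rewrite mul0r msize0.
have [->|r0] := eqVneq r 0; first by rewrite mulr0 msize0.
rewrite msizeM_proper ?mulf_neq0 ?mleadc_eq0 //.
move: szq szr; rewrite -(mlead_deg q0) -(mlead_deg r0) !ltnS => szq szr.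
by rewrite addSn addnS ltnS leq_add.
Qed.

Lemma D_sum (I : eqType) (s : seq I) (k n : nat) (F : I -> nary 'F_p n) :
  (forall i, i \in s -> D p k (Op (F i))) -> D p k (Op (fun x => \sum_(i <- s) F i x)).
Proof.
elim: s => [|i s IH] Fs.
  by apply: (eq_class (f := fun=> 0)) => [x|]; [rewrite big_nil | apply: D_const].
apply: (eq_class (f := fun x => F i x + \sum_(j <- s) F j x)) => [x|].
  by rewrite big_cons.
apply: D_add; first by apply: Fs; rewrite inE eqxx.
by apply: IH => j js; apply: Fs; rewrite inE js orbT.
Qed.

Lemma D_exp (k e n : nat) (f : nary 'F_p n) :
  D p k (Op f) -> D p (e * k) (Op (fun x => f x ^+ e)).
Proof.
move=> Df; elim: e => [|e IH]; first exact: D_const.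
apply: (eq_class (f := fun x => f x * f x ^+ e)) => [x|]; first by rewrite exprS.
by rewrite mulSn; apply: D_mul.
Qed.

Lemma D_prod (I : Type) (s : seq I) (k : I -> nat) (n : nat) (F : I -> nary 'F_p n) :
  (forall i, D p (k i) (Op (F i))) ->
  D p (\sum_(i <- s) k i) (Op (fun x => \prod_(i <- s) F i x)).
Proof.
move=> DF; elim: s => [|i s IH].
  by apply: (eq_class (f := fun=> 1)) => [x|]; [rewrite big_nil | apply: D_const].
apply: (eq_class (f := fun x => F i x * \prod_(j <- s) F j x)) => [x|].
  by rewrite big_cons.
by rewrite big_cons; apply: D_mul.
Qed.

Lemma D_compose (a b n m : nat) (f : nary 'F_p n) (g : 'I_n.+1 -> nary 'F_p m) :
  D p a (Op f) -> (forall i, D p b (Op (g i))) -> D p (a * b) (Op (compose f g)).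
Proof.
move=> /in_D[q qf szq] Dg.
apply: (eq_class (f := fun x => \sum_(u <- msupp q) q@_u * \prod_i g i x ^+ u i)) => [x|].
  rewrite /compose qf mevalE; apply: eq_bigr => u _.
  by congr (_ * _); apply: eq_bigr => i _; rewrite tnth_mktuple.
(* The [0] is the degree of the constant factor [q@_u]. *)
apply: D_sum => u uq; apply: (@D_le (0 + mdeg u * b)%N).
  by rewrite leq_mul // -ltnS (leq_trans (msize_mdeg_lt uq)).
apply: D_mul; first exact: D_const.
rewrite mdegE big_distrl /=; apply: (D_prod _ (k := fun i => (u i * b)%N)) => i.
exact: D_exp.
Qed.

(** By Fermat, 1 - y ^ (p - 1) is 1 at y = 0 and 0 elsewhere. *)
Lemma indicatorE (n : nat) (a x : n.-tuple 'F_p) :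
  \prod_i (1 - (tnth x i - tnth a i) ^+ p.-1) = (a == x)%:R.
Proof.
have [-> | ax] := eqVneq a x.
  apply: big1 => i _; rewrite subrr expr0n -subn1 subn_eq0 leqNgt prime_gt1 //.
  exact: subr0.
have [i ai] : exists i, tnth x i - tnth a i != 0.
  apply/existsP; apply: contraR ax; rewrite negb_exists => /forallP ax.
  by apply/eqP/eq_from_tnth => i; apply/esym/eqP; rewrite -subr_eq0 -[_ == _]negbK ax.
rewrite (bigD1 i) //= (_ : _ ^+ _ = 1) ?subrr ?mul0r //.
by apply: (mulfI ai); rewrite -exprS expFp mulr1.
Qed.

(** Lagrange interpolation: [f] is the sum of [f a] times the indicator of [a], a product of one
    factor of degree p - 1 per variable. *)
Lemma D_exhaustive (n : nat) (f : nary 'F_p n) : exists k, D p k (Op f).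
Proof.
exists (0 + \sum_(i < n.+1) p.-1 * 1)%N.
pose F (a x : n.+1.-tuple 'F_p) :=
  f a * \prod_i (1 + (-1) * (tnth x i + - tnth a i) ^+ p.-1).
apply: (eq_class (f := fun x => \sum_(a <- index_enum _) F a x)) => [x|].
  transitivity (\sum_a f a * (a == x)%:R).
    apply: eq_bigr => a _; congr (_ * _); rewrite -indicatorE.
    by apply: eq_bigr => i _; rewrite mulN1r.
  rewrite (bigD1 x) //= eqxx mulr1 big1 ?addr0 // => a /negPf->.
  exact: mulr0.
apply: D_sum => a _; apply: D_mul; first exact: D_const.
apply: (D_prod _ (k := fun=> (p.-1 * 1)%N)) => i.
apply: D_add; first exact: D_const.
apply: (D_mul (a := 0)); first exact: D_const.
by apply/D_exp/D_add; [apply: D_proj | apply: D_const].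
Qed.

End DegreeClasses.

(** * Classes stable under affine operations *)

Section StableClasses.

Local Open Scope ring_scope.

Variables (p : nat) (K : set (operation 'F_p)).
Hypotheses (p_pr : prime p) (stK : stable (L p) K).

Lemma stable_subst (n m : nat) (f : nary 'F_p n) (g : 'I_n.+1 -> nary 'F_p m) :
  K (Op f) -> (forall i, L p (Op (g i))) -> K (Op (compose f g)).
Proof. by move=> Kf Lg; apply: stK.1; exists n, m, f, g. Qed.

Lemma stable_affine (n : nat) (f g : nary 'F_p n) (a b c : 'F_p) :
  K (Op f) -> K (Op g) -> K (Op (fun x => a * f x + b * g x + c)).
Proof.
move=> Kf Kg.
pose F (z : 2.-tuple 'F_p) := a * tnth z ord0 + b * tnth z ord_max + c.
apply: (eq_class (f := compose F (fun i => if i == ord0 then f else g))) => [x|].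
  by rewrite /compose /F !tnth_mktuple.
apply: stK.2; exists 1%N, n, F, (fun i => if i == ord0 then f else g).
split=> // [|i]; last by case: ifP.
have affine_proj (e : 'F_p) i : L p (Op (fun z : 2.-tuple 'F_p => e * tnth z i)).
  by apply: (D_mul p_pr (a := 0) (b := 1)); [apply: D_const | apply: D_proj].
apply: (D_add p_pr); last exact: D_const.
exact: (D_add p_pr (affine_proj a _) (affine_proj b _)).
Qed.

Lemma stable_const (n m : nat) (f : nary 'F_p n) (c : 'F_p) :
  K (Op f) -> K (Op (fun _ : m.+1.-tuple 'F_p => c)).
Proof.
(* Substituting zeros passes from the arity of [f] to the required one; an affine map then sets the
   value to [c]. *)
move=> Kf; pose g (_ : 'I_n.+1) (_ : m.+1.-tuple 'F_p) : 'F_p := 0.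
have Kg : K (Op (compose f g)) by apply: stable_subst => // i; apply: D_const.
apply: eq_class (stable_affine 0 0 c Kg Kg) => x.
by rewrite !mul0r !add0r.
Qed.

(** The operation [f] witnesses that [K] is nonempty, which puts the empty sum in [K]. *)
Lemma stable_sum (k n : nat) (f : nary 'F_p k) (I : eqType) (s : seq I)
    (c : I -> 'F_p) (F : I -> nary 'F_p n) :
  K (Op f) -> (forall i, i \in s -> K (Op (F i))) ->
  K (Op (fun x => \sum_(i <- s) c i * F i x)).
Proof.
move=> Kf; elim: s => [|i s IH] KF.
  by apply: eq_class (stable_const n 0 Kf) => x; rewrite big_nil.
have Ki : K (Op (F i)) by apply: KF; rewrite inE eqxx.
have Ks : K (Op (fun x => \sum_(j <- s) c j * F j x)).
  by apply: IH => j js; apply: KF; rewrite inE js orbT.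
by apply: eq_class (stable_affine (c i) 1 0 Ki Ks) => x; rewrite big_cons mul1r addr0.
Qed.

(** Since [mlead q] has maximal degree in [q], [polarization] applies to every monomial of [q] and
    annihilates all but this one. *)
Lemma stable_prod_slot (n N : nat) (f : nary 'F_p n) (q : {mpoly 'F_p[n.+1]})
    (l : slot (mlead q) -> nary 'F_p N) :
  K (Op f) -> Defs.reduced q -> represents q f -> q != 0 ->
  (forall j, L p (Op (l j))) -> K (Op (fun x => \prod_j l j x)).
Proof.
move=> Kf red_q qf q0 Ll; set m := mlead q in l Ll *.
have mq : m \in msupp q by apply: mlead_supp.
pose F (S : {set slot m}) i j (x : N.+1.-tuple 'F_p) :=
  if (j \in S) && (tag j == i) then l j x else 0.
pose g S (i : 'I_n.+1) x := \sum_j F S i j x.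
have Kg S : K (Op (compose f (g S))).
  apply: stable_subst => // i; apply: (D_sum p_pr (F := F S i)) => j _.
  by rewrite /F; case: (_ && _); [apply: Ll | apply: D_const].
have := stable_sum (s := index_enum _) (fun S => (-1) ^+ #|~: S|) Kf (fun S _ => Kg S).
pose c := q@_m * #|slot_perms m|%:R.
(* Reducedness makes every fibre of [tag] smaller than p, so the group order is nonzero modulo p. *)
have c0 : c != 0.
  rewrite mulf_neq0 -?mcoeff_msupp //= -(dvdn_pcharf (pchar_Fp p_pr)).
  apply: prime_ndvd_fibre_perms => // j; rewrite card_slot_fibre.
  by rewrite -(prednK (prime_gt0 p_pr)) ltnS red_q.
move=> Ksum; apply: eq_class (stable_affine c^-1 0 0 Ksum Ksum) => x.
rewrite mul0r !addr0; apply: (mulfI c0); rewrite mulrA divff // mul1r.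
(* Expanding [q] and interchanging the sums lets the alternating sum be taken monomial by
   monomial. *)
transitivity (\sum_(u <- msupp q) q@_u *
    (\sum_(S : {set slot m}) (-1) ^+ #|~: S| *
      \prod_i (\sum_(j in S | tag j == i) l j x) ^+ u i)); last first.
  rewrite (bigD1_seq m) ?msupp_uniq //= polarization //.
  rewrite eqxx mul1r mulrA [X in _ + X]big_seq_cond.
  rewrite [X in _ + X]big1 ?addr0 // => u /andP[uq um].
  rewrite polarization ?(negPf um) ?mul0r ?mulr0 //.
  by rewrite -ltnS mlead_deg // msize_mdeg_lt.
under [RHS]eq_bigr do rewrite mulr_sumr.
rewrite [RHS]exchange_big /=; apply: eq_bigr => S _.
rewrite [compose _ _ _]qf mevalE mulr_sumr; apply: eq_bigr => u _.
rewrite mulrCA; congr (_ * (_ * _)); apply: eq_bigr => i _.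
by rewrite tnth_mktuple /g /F -big_mkcond.
Qed.

(** The slots of [mlead q] receive one coordinate form per variable occurrence in [u], and the
    constant 1, the default of [nth], once these are exhausted. *)
Lemma stable_monomial (n N : nat) (f : nary 'F_p n) (q : {mpoly 'F_p[n.+1]})
    (u : 'X_{1..N.+1}) :
  K (Op f) -> Defs.reduced q -> represents q f -> q != 0 -> (mdeg u <= mdeg (mlead q))%N ->
  K (Op (fun x => \prod_i tnth x i ^+ u i)).
Proof.
move=> Kf red_q qf q0 le_u.
pose l (j : slot (mlead q)) (x : N.+1.-tuple 'F_p) :=
  nth 1 [seq tnth x (tag t) | t <- enum (slot u)] (enum_rank j).
apply: (eq_class (f := fun x => \prod_j l j x)) => [x|].
  rewrite (reindex (@enum_val (slot (mlead q)) predT)) /=; last exact/onW_bij/enum_val_bij.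
  under eq_bigr => k _ do rewrite /l enum_valK.
  rewrite prod_nth_pad; last by rewrite size_map -cardE !card_slot.
  by rewrite big_map big_enum prod_slot.
apply: (stable_prod_slot (l := l) Kf red_q qf q0) => j.
have [lt_j | le_j] := ltnP (enum_rank j) #|{: slot u}|.
  pose t := enum_val (Ordinal lt_j).
  apply: eq_class (D_proj p_pr (tag t)) => x.
  by rewrite /l (nth_map t) -?cardE // -(enum_val_nth t (Ordinal lt_j)).
apply: eq_class (D_const p_pr _ _ 1) => x.
by rewrite /l nth_default // size_map -cardE.
Qed.

Lemma stable_D (n d : nat) (f : nary 'F_p n) :
  K (Op f) -> has_degree f d -> (D p d `<=` K)%classic.
Proof.
move=> Kf [q [red_q qf ->]] [N h] /(in_D p_pr)[r rh szr].
(* The zero polynomial has no leading monomial; its degree is 0 by convention, so [r] is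
   constant. *)
have [q0|q0] := eqVneq q 0.
  have rC : r = (r@_0)%:MP by apply: msize1_polyC; rewrite q0 msize0 in szr.
  by apply: eq_class (stable_const N r@_0 Kf) => x; rewrite rh rC mevalC mcoeffC eqxx mulr1.
pose mono (u : 'X_{1..N.+1}) (x : N.+1.-tuple 'F_p) := \prod_i tnth x i ^+ u i.
have Kmono u : u \in msupp r -> K (Op (mono u)).
  move=> ur; apply: (stable_monomial Kf red_q qf q0).
  rewrite -ltnS (leq_trans (msize_mdeg_lt ur)) // (leq_trans szr) //.
  by rewrite -(mlead_deg q0).
have Ksum := stable_sum (fun u => r@_u) Kf Kmono.
by apply: eq_class Ksum => x; rewrite [RHS]rh mevalE.
Qed.

End StableClasses.

(** * Classification of the stable classes by the degrees occurring in them *)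

Local Open Scope classical_set_scope.

Theorem theorem4p8 (p : nat) (p_pr : prime p) (K : set (operation 'F_p)) :
  stable (L p) K <-> [\/ K = setT, exists k : nat, K = D p k | K = set0].
Proof.
split=> [stK | [-> | [k ->] | ->]]; last first.
(* Arities are positive, so the index [ord0] would give a member of the empty class. *)
- by split=> h [n [m [f [g []]]]] // _ /(_ ord0).
- split=> h [n [m [f [g [Df Dg ->]]]]].
    by rewrite -[k]muln1; apply: D_compose.
  by rewrite -[k]mul1n; apply: D_compose.
- by [].
have [[f Kf] | K0] := pselect (K !=set0); last first.
  apply: Or33; apply/seteqP; split=> // f Kf; case: K0; by exists f.
pose P (d : nat) := exists2 f, K f & has_degree (projT2 f) d.
have DK d : P d -> D p d `<=` K by move=> [[n g] Kg dg]; apply: stable_D dg.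
have all_D (g : operation 'F_p) : exists d, has_degree (projT2 g) d.
  by case: g => n g; have [k [d gd _]] := D_exhaustive p_pr g; exists d.
have [[B leB] | unbounded] := pselect (exists B, forall d, P d -> (d <= B)%N); last first.
  apply: Or31; apply/seteqP; split=> // g _; have [d gd] := all_D g.
  (* If [g], of degree [d], lay outside [K], no degree [e > d] could occur in [K], as [K] would
     contain [D p e] and hence [g]; so [d] would bound the degrees. *)
  apply: contrapT => nKg; apply: unbounded; exists d => e Pe.
  by rewrite leqNgt; apply/negP => /ltnW led; apply/nKg/(DK e Pe); exists d.
apply: Or32; have exP : exists d, `[< P d >].
  by have [d fd] := all_D f; exists d; apply/asboolP; exists f.
have ubP d : `[< P d >] -> (d <= B)%N by move/asboolP/leB.
case: (ex_maxnP exP ubP) => d /asboolP Pd dmax; exists d.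
apply/seteqP; split=> [g Kg | ]; last exact: DK.
have [e ge] := all_D g; exists e => //; apply: dmax; apply/asboolP; by exists g.
Qed.
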